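(* Let $A,B\in\mathcal{M}_n^+$. Then $$A\nabla B-A!B=\frac14(A-B)(A\nabla B)^{-1}(A-B).$$ In particular, if $A\le B$, then $$\frac14(A-B)B^{-1}(A-B)\;\le\; A\nabla B-A!B\;\le\;\frac14(A-B)A^{-1}(A-B).$$ Consequently, if $A\le B$, then for $j=1,2,\dots,n$, $$\frac14\, s_j\!\left(B^{-\frac12}(A-B)^2B^{-\frac12}\right)\le s_j(A\nabla B-A!B)\le\frac14\, s_j\!\left(A^{-\frac12}(A-B)^2A^{-\frac12}\right).$$
   Context: $\mathcal{M}_n^+$ denotes the set of positive (definite) $n\times n$ complex matrices: $A\in\mathcal{M}_n^+$ iff $\langle Ax,x\rangle>0$ for all nonzero $x\in\mathbb{C}^n$. For Hermitian matrices, $X\le Y$ means that $Y-X$ is positive semidefinite. For $A,B\in\mathcal{M}_n^+$, the arithmetic mean is $A\nabla B=\frac{A+B}{2}$ and the harmonic mean is $A!B=\left(\frac{A^{-1}+B^{-1}}{2}\right)^{-1}$. $s_j(X)$ denotes the $j$-th singular value of the $n\times n$ matrix $X$, the singular values being arranged in decreasing order and counted with multiplicity. *)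

(* Defs.v *)
From HB Require Import structures.
From mathcomp Require Import all_boot all_order all_algebra.
From mathcomp Require Import complex reals.

Set Implicit Arguments.
Unset Strict Implicit.
Unset Printing Implicit Defensive.

Import Order.TTheory GRing.Theory Num.Theory.
Local Open Scope ring_scope.
Local Open Scope sesquilinear_scope.

Section Definitions.
Context {C : numClosedFieldType} {n : nat}.
Implicit Types A B X Y : 'M[C]_n.

(* In a numClosedFieldType, [0 < z] and [0 <= z] entail that z is real, so the
   two predicates below force the matrix to be Hermitian. *)
Definition posdefmx A : Prop :=
  forall x : 'cV[C]_n, x != 0 -> 0 < (x^t* *m (A *m x)) 0 0.

Definition psdmx A : Prop :=
  forall x : 'cV[C]_n, 0 <= (x^t* *m (A *m x)) 0 0.

Definition loewner X Y : Prop := psdmx (Y - X).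

Definition amean A B : 'M[C]_n := 2^-1 *: (A + B).

Definition hmean A B : 'M[C]_n := invmx (2^-1 *: (invmx A + invmx B)).

(* Spectral calculus, with the spectral decomposition
   [A = invmx P *m diag_mx d *m P] of a normal matrix (P unitary);
   meaningful for A positive semidefinite. *)
Definition sqrtmx A : 'M[C]_n :=
  invmx (spectralmx A) *m diag_mx (map_mx sqrtC (spectral_diag A))
    *m spectralmx A.

(* A^(-1/2) *)
Definition rsqrtmx A : 'M[C]_n := invmx (sqrtmx A).

(* [spectral_diag] lists the eigenvalues of the Hermitian matrix X^* X with
   multiplicity, in no particular order; they are nonnegative, so the values
   sorted here are pairwise comparable. *)
Definition singular_values X : seq C :=
  sort (fun a b => b <= a)
    [seq sqrtC (spectral_diag (X^t* *m X) 0 i) | i <- enum 'I_n].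

(* Indexed from 0: [singular_value X j] is s_(j+1)(X). *)
Definition singular_value X (j : 'I_n) : C := nth 0 (singular_values X) j.

End Definitions.

(* Main.v *)
(** With [M] the arithmetic mean and [D = (A - B) / 2], the harmonic mean is
    [A M^-1 B = (M + D) M^-1 (M - D) = M - D M^-1 D]. If [A <= B] then
    [A <= M <= B], so antitonicity of the inverse bounds [D M^-1 D] by
    [D B^-1 D] and [D A^-1 D]. Singular values are monotone on positive
    semidefinite matrices, and those of [D X^-1 D] are those of
    [X^(-1/2) D^2 X^(-1/2)], these being [Z Z^*] and [Z^* Z] for
    [Z = D X^(-1/2)]. *)
Require Import Defs.
From mathcomp Require Import all_boot all_order all_algebra.
From mathcomp Require Import complex reals.
From mathcomp Require Import ring.
Import Order.TTheory GRing.Theory Num.Theory.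
Local Open Scope ring_scope.

(** * Characteristic polynomials of products, conjugates and diagonal matrices *)

Section CharPoly.
Variables (F : fieldType) (n : nat).
Implicit Types A B D P : 'M[F]_n.

Lemma char_poly_mulmxC A B : char_poly (A *m B) = char_poly (B *m A).
Proof.
(* The determinant of [[1, b], [a, 'X]] computed in two ways, clearing either
   off-diagonal block. *)
pose a := map_mx polyC A; pose b := map_mx polyC B.
have nz : ('X : {poly F}) ^+ n != 0 by rewrite expf_eq0 polyX_eq0 andbF.
have E1 : block_mx 1%:M b a 'X%:M *m block_mx 'X%:M 0 (- a) 1%:M
   = block_mx ('X%:M - b *m a) b 0 'X%:M.
  rewrite mulmx_block !mul1mx !mulmx0 !add0r.
  by rewrite !mulmxN !mulmx1 scalar_mxC subrr.
have E2 : block_mx 1%:M 0 (- a) 1%:M *m block_mx 1%:M b a 'X%:M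
   = block_mx 1%:M b 0 ('X%:M - a *m b).
  rewrite mulmx_block !mul1mx !mul0mx !addr0 mulmx1 addNr mulNmx.
  by rewrite addrC.
have := congr1 determinant E1; have := congr1 determinant E2.
rewrite !det_mulmx !det_ublock !det_lblock !det1 !mul1r mulr1 => ->.
rewrite det_scalar => /(mulIf nz).
by rewrite /char_poly /char_poly_mx !map_mxM.
Qed.

Lemma char_poly_conj P D : P \in unitmx ->
  char_poly (invmx P *m D *m P) = char_poly D.
Proof. by move=> uP; rewrite char_poly_mulmxC mulKVmx. Qed.

Lemma char_poly_diag (d : 'rV[F]_n) :
  char_poly (diag_mx d) = \prod_(x <- [seq d 0 i | i <- enum 'I_n]) ('X - x%:P).
Proof.
rewrite char_poly_trig; last by apply: diag_mx_is_trig.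
rewrite big_map big_enum /=.
by apply: eq_bigr => i _; rewrite mxE eqxx mulr1n.
Qed.
End CharPoly.

Section Spectrum.
Local Open Scope sesquilinear_scope.
Variables (C : numClosedFieldType) (n : nat).
Implicit Types A B D P X Y Z : 'M[C]_n.

(** * Eigenvalue lists up to order *)

Definition spectrum (d : 'rV[C]_n) := [seq d 0 i | i <- enum 'I_n].

(** Every diagonalization lists the roots of the same characteristic polynomial, so the one chosen
    by [spectral_diag] can be traded for any convenient one, up to order. *)
Lemma perm_spectral_diag X d P : P \is unitarymx ->
  X = invmx P *m diag_mx d *m P ->
  perm_eq (spectrum (spectral_diag X)) (spectrum d).
Proof.
move=> uP eX; apply: prod_XsubC_eq; rewrite -!char_poly_diag.
have nX : X \is normalmx by apply/orthomx_spectral_subproof; exists (P, d).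
rewrite -(char_poly_conj _ _ P (diag_mx d)) ?unitarymx_unit // -eX.
by rewrite {2}(orthomx_spectralP nX) char_poly_conj ?spectral_unit.
Qed.

Lemma perm_spectral_diag_char_poly X Y : X \is normalmx -> Y \is normalmx ->
  char_poly X = char_poly Y ->
  perm_eq (spectrum (spectral_diag X)) (spectrum (spectral_diag Y)).
Proof.
move=> nX nY e; apply: prod_XsubC_eq; rewrite -!char_poly_diag.
rewrite -(char_poly_conj _ _ (spectralmx X)) ?spectral_unit //.
rewrite -(orthomx_spectralP nX) e.
by rewrite {1}(orthomx_spectralP nY) char_poly_conj ?spectral_unit.
Qed.

(** * Positive semidefinite matrices and the Loewner order *)

Lemma trmxC_mul m p q (A : 'M[C]_(m, p)) (B : 'M[C]_(p, q)) :
  (A *m B)^t* = B^t* *m A^t*.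
Proof. by rewrite trmx_mul map_mxM. Qed.

Lemma psdmx_hermitian X : psdmx X -> X^t* = X.
Proof.
move=> pX; pose q (x y : 'cV[C]_n) : C := (x^t* *m (X *m y)) 0 0.
pose e i : 'cV[C]_n := delta_mx i 0.
have qe i j : q (e i) (e j) = X i j.
  rewrite /q -colE mxE (bigD1 i) //= !mxE !eqxx /= conjC1 mul1r big1 ?addr0 //.
  by move=> k ki; rewrite !mxE eqxx andbT (negPf ki) conjC0 mul0r.
have qDZ x y c : q (x + c *: y) (x + c *: y) =
    q x x + c * q x y + c^* * q y x + c^* * c * q y y.
  rewrite /q linearD /= linearZ /= map_mxD map_mxZ mulmxDr !mulmxDl !mulmxDr.
  rewrite -!scalemxAr -!scalemxAl !mxE.
  ring.
have real_q x : (q x x)^* = q x x by apply/CrealP/ger0_real/pX.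
(* The cases c = 1 and c = 'i determine [(X j i)^*]. *)
have pol i j c : (c * X i j + c^* * X j i)^* = c * X i j + c^* * X j i.
  have := real_q (e i + c *: e j); rewrite qDZ !qe => h.
  have /= hi := real_q (e i); have /= hj := real_q (e j).
  rewrite !qe in hi hj; move: h.
  rewrite !rmorphD !rmorphM /= conjCK hi hj => h.
  apply: (addrI (X i i)); apply: (addIr (c^* * c * X j j)).
  by rewrite -[RHS]addrA !addrA -h; ring.
apply/matrixP=> i j; rewrite !mxE.
have h1 := pol j i 1; have hI := pol j i 'i.
rewrite conjC1 !mul1r !rmorphD /= in h1.
rewrite !rmorphD !rmorphM /= conjCK conjCi in hI.
have n2 : (2 : C) != 0 by rewrite pnatr_eq0.
have ni : ('i : C) != 0 by apply: neq0Ci.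
(* After multiplication by [2] and ['i], the goal is ['i] times the case [c = 1] minus the case
   [c = 'i]; the terms in [X j i] cancel on the right. *)
apply: (mulfI n2); apply: (mulfI ni).
have -> : 'i * (2 * (X j i)^* ) = 'i * ((X j i)^* + (X i j)^* )
   - (- 'i * (X j i)^* + 'i * (X i j)^* ) by ring.
rewrite h1 hI; ring.
Qed.

Lemma psdmx_normal X : psdmx X -> X \is normalmx.
Proof. by move=> /psdmx_hermitian hX; apply/normalmxP; rewrite hX. Qed.

Lemma psdmxD X Y : psdmx X -> psdmx Y -> psdmx (X + Y).
Proof.
by move=> pX pY x; rewrite mulmxDl mulmxDr mxE addr_ge0.
Qed.

Lemma psdmxZ c X : 0 <= c -> psdmx X -> psdmx (c *: X).
Proof. by move=> c0 pX x; rewrite -scalemxAl -scalemxAr mxE mulr_ge0. Qed.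

Lemma psdmx_congr X Z : psdmx X -> psdmx (Z^t* *m X *m Z).
Proof. by move=> pX x; rewrite -!mulmxA mulmxA -trmxC_mul. Qed.

Lemma posdefmx_psd X : posdefmx X -> psdmx X.
Proof.
move=> pX x; have [->|x0] := eqVneq x 0; first by rewrite !mulmx0 mxE.
exact/ltW/pX.
Qed.

Lemma posdefmxD_psd X Y : posdefmx X -> psdmx Y -> posdefmx (X + Y).
Proof.
move=> pX pY x x0; rewrite mulmxDl mulmxDr mxE ltr_wpDr //; exact: pX.
Qed.

Lemma posdefmxZ c X : 0 < c -> posdefmx X -> posdefmx (c *: X).
Proof.
by move=> c0 pX x x0; rewrite -scalemxAl -scalemxAr mxE mulr_gt0 ?pX.
Qed.

(** The quadratic form would vanish at a nonzero kernel vector. Transposes appear because [kermx] is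
    a left kernel. *)
Lemma posdefmx_unit X : posdefmx X -> X \in unitmx.
Proof.
move=> pX; rewrite -unitmx_tr -row_free_unit -kermx_eq0; apply/eqP/row_matrixP.
move=> i; rewrite row0; apply: contraTeq isT => r0.
have z : X *m (row i (kermx X^T))^T = 0.
  by apply: trmx_inj; rewrite trmx_mul trmxK -row_mul mulmx_ker row0 trmx0.
by have := pX (row i (kermx X^T))^T; rewrite trmx_eq0 => /(_ r0);
  rewrite z mulmx0 mxE ltxx.
Qed.

Lemma invmx_hermitian X : X^t* = X -> (invmx X)^t* = invmx X.
Proof. by move=> hX; rewrite trmx_inv map_invmx hX. Qed.

(** The inverse is Hermitian, hence it is the congruence of [X] by [invmx X]. *)
Lemma psdmx_inv X : posdefmx X -> psdmx (invmx X).
Proof.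
move=> pX; have uX := posdefmx_unit X pX.
have hX := psdmx_hermitian X (posdefmx_psd X pX).
have := psdmx_congr X (invmx X) (posdefmx_psd X pX).
by rewrite invmx_hermitian // mulVmx // mul1mx.
Qed.

Lemma loewner_inv X Y : posdefmx X -> loewner X Y ->
  loewner (invmx Y) (invmx X).
Proof.
move=> pX; rewrite {1}/loewner => pP.
have eP : Y = X + (Y - X) by rewrite addrC subrK.
move: (Y - X) => P in pP eP; rewrite {Y}eP.
have pY : posdefmx (X + P) by apply: posdefmxD_psd.
have [uX uY] := (posdefmx_unit X pX, posdefmx_unit _ pY).
have hY := invmx_hermitian _ (psdmx_hermitian _ (posdefmx_psd _ pY)).
have hP := psdmx_hermitian P pP.
(* [X^-1 - Y^-1 = Y^-1 P Y^-1 + Y^-1 P X^-1 P Y^-1] with [Y = X + P] *)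
have := psdmxD _ _ (psdmx_congr P (invmx (X + P)) pP)
  (psdmx_congr (invmx X) (P *m invmx (X + P)) (psdmx_inv X pX)).
rewrite trmxC_mul hY hP /loewner.
rewrite (_ : _ + _ = invmx X - invmx (X + P)) //.
apply: (can_inj (mulmxK uY)); rewrite mulmxBl mulVmx // mulmxDl -!mulmxA.
rewrite !(mulVmx uY) !mulmx1 -mulmxDr [in RHS]mulmxDr (mulVmx uX).
rewrite [1%:M + _]addrC addrK.
apply: (can_inj (mulKmx uY)).
by rewrite mulKVmx // mulmxDl mulKVmx.
Qed.

(** * Quadratic forms in an eigenbasis and eigenvalue counting *)

Lemma qform_spectral X (v : 'cV[C]_n) : X \is normalmx ->
  (v^t* *m (X *m v)) 0 0 =
    \sum_i spectral_diag X 0 i * `|(spectralmx X *m v) i 0| ^+ 2.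
Proof.
move=> /orthomx_spectralP eX; rewrite {1}eX.
rewrite invmx_unitary ?spectral_unitarymx // -!mulmxA.
rewrite [v^t* *m _]mulmxA -trmxC_mul mxE; apply: eq_bigr => i _.
by rewrite mul_diag_mx !mxE normCK mulrCA [_ * _^*]mulrC.
Qed.

Lemma sqnorm_unitary P (v : 'cV[C]_n) : P \is unitarymx ->
  \sum_i `|(P *m v) i 0| ^+ 2 = (v^t* *m v) 0 0.
Proof.
move=> uP; have -> : v^t* *m v = (P *m v)^t* *m (P *m v).
  rewrite trmxC_mul -mulmxA -invmx_unitary // mulKmx //.
  exact: unitarymx_unit.
by rewrite mxE; apply: eq_bigr => i _; rewrite !mxE normCKC.
Qed.

Lemma spectral_diag_ge0 X i : psdmx X -> 0 <= spectral_diag X 0 i.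
Proof.
move=> pX; have uP := spectral_unit X.
(* This is the [i]-th unit eigenvector, where the form takes the [i]-th eigenvalue. *)
have := pX (invmx (spectralmx X) *m delta_mx i 0).
rewrite qform_spectral ?psdmx_normal // mulKVmx // (bigD1 i) //= big1.
  by rewrite mxE !eqxx normr1 expr1n mulr1 addr0.
by move=> k ki; rewrite mxE (negPf ki) normr0 expr0n mulr0.
Qed.

Lemma underdetermined_ker m (M : 'M[C]_(m, n)) : (m < n)%N ->
  exists2 v : 'cV[C]_n, v != 0 & M *m v = 0.
Proof.
move=> ltmn; have : kermx M^T != 0.
  rewrite -mxrank_eq0 mxrank_ker -lt0n subn_gt0.
  exact: leq_ltn_trans (rank_leq_col _) ltmn.
case/rowV0Pn=> u /sub_kermxP u0 un0; exists u^T; first by rewrite trmx_eq0.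
by apply: trmx_inj; rewrite trmx_mul trmxK u0 trmx0.
Qed.

(** Stacking the selected rows of [P] and [Q] gives a homogeneous system with fewer equations than
    unknowns. For eigenbases [P] and [Q], this makes two spectral subspaces meet nontrivially. *)
Lemma exists_common_zero (P Q : 'M[C]_n) (S T : {set 'I_n}) :
  (#|S| + #|T| < n)%N ->
  exists2 v : 'cV[C]_n, v != 0 &
    (forall i, i \in S -> (P *m v) i 0 = 0) /\
    (forall i, i \in T -> (Q *m v) i 0 = 0).
Proof.
move=> lt; have sub0 (U : {set 'I_n}) (M : 'M[C]_n) v :
    rowsub (@enum_val _ (mem U)) M *m v = 0 :> 'cV[C]__ ->
    forall i, i \in U -> (M *m v) i 0 = 0.
  move=> /matrixP e i iU; have := e (enum_rank_in iU i) 0.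
  rewrite !mxE => h; rewrite -[RHS]h; apply: eq_bigr => k _.
  by rewrite mxE enum_rankK_in.
have [v v0] := underdetermined_ker _
  (col_mx (rowsub (@enum_val _ (mem S)) P) (rowsub (@enum_val _ (mem T)) Q)) lt.
rewrite mul_col_mx => /eqP; rewrite col_mx_eq0 => /andP[/eqP hS /eqP hT].
by exists v => //; split; apply: sub0.
Qed.

(* Otherwise, by dimension count, some [v != 0] lies in the span of the
   eigenvectors of X with eigenvalue >= t and in that of the eigenvectors of Y
   with eigenvalue < t, so that [t |v|^2 <= v^* X v <= v^* Y v < t |v|^2]. *)
Lemma leq_card_spectral_diag X Y t : 0 <= t -> psdmx X -> loewner X Y ->
  (#|[set i | (t <= spectral_diag X 0 i)%R]|
    <= #|[set i | (t <= spectral_diag Y 0 i)%R]|)%N.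
Proof.
move=> t0 pX XY; have pY : psdmx Y.
  by rewrite -[Y](subrK X); apply: psdmxD.
rewrite leqNgt; apply/negP => lt.
(* [T] holds the indices of eigenvalues of [Y] that are at least [t], and [S] those of [X]. *)
set T := [set i | _] in lt; set S := [set i | _] in lt.
have lt' : (#|~: S| + #|T| < n)%N.
  by rewrite -[X in (_ < X)%N](card_ord n) -(cardsC S) addnC ltn_add2r.
have [v v0 [vS vT]] :=
  exists_common_zero (spectralmx X) (spectralmx Y) _ _ lt'.
have uX := spectral_unitarymx X; have uY := spectral_unitarymx Y.
pose wX i : C := `|(spectralmx X *m v) i 0| ^+ 2.
pose wY i : C := `|(spectralmx Y *m v) i 0| ^+ 2.
have wX0 i : 0 <= wX i by rewrite exprn_ge0.
have wY0 i : 0 <= wY i by rewrite exprn_ge0.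
have leX : t * (v^t* *m v) 0 0 <= (v^t* *m (X *m v)) 0 0.
  rewrite -(sqnorm_unitary (spectralmx X)) // mulr_sumr.
  rewrite qform_spectral ?psdmx_normal //; apply: ler_sum => i _.
  have [iS|iS] := boolP (i \in S); last first.
    by rewrite vS ?in_setC // normr0 expr0n !mulr0.
  by rewrite ler_wpM2r ?wX0 //; rewrite inE in iS.
have leXY : (v^t* *m (X *m v)) 0 0 <= (v^t* *m (Y *m v)) 0 0.
  by have := XY v; rewrite mulmxBl mulmxBr !mxE subr_ge0.
have := le_trans leX leXY.
rewrite -(sqnorm_unitary (spectralmx Y)) // mulr_sumr.
rewrite qform_spectral ?psdmx_normal // -subr_ge0 -sumrB => sum0.
have ltY i : i \notin T -> spectral_diag Y 0 i < t.
  by rewrite inE -real_ltNge ?ger0_real ?spectral_diag_ge0.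
have term0 i : 0 <= (t - spectral_diag Y 0 i) * wY i.
  have [iT|iT] := boolP (i \in T).
    by rewrite /wY vT // normr0 expr0n mulr0.
  by rewrite mulr_ge0 // subr_ge0 ltW ?ltY.
(* Nonnegative terms with a nonpositive sum all vanish. Off [T] the factor [t - spectral_diag Y 0 i]
   is positive, so the coordinate of [v] is zero there too, contradicting [v != 0]. *)
have sumE : \sum_i (t - spectral_diag Y 0 i) * wY i == 0.
  rewrite eq_le sumr_ge0 ?andbT // -oppr_ge0 -sumrN.
  by under eq_bigr => i _ do rewrite -mulNr opprB mulrBl.
have Yv0 : spectralmx Y *m v = 0.
  apply/matrixP => i j; rewrite ord1 [RHS]mxE.
  have [iT|iT] := boolP (i \in T); first exact: vT.
  move: sumE; rewrite psumr_eq0 // => /allP/(_ i (mem_index_enum i)) /=.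
  rewrite mulf_eq0 subr_eq0 gt_eqF ?ltY //= /wY expf_eq0 normr_eq0 /=.
  by move/eqP.
case/eqP: v0; rewrite -(mulKmx (unitarymx_unit uY) v) Yv0.
exact: mulmx0.
Qed.

(** * Sorted spectra and singular values *)

Definition sort_ge := sort (fun a b : C => b <= a).

Lemma ge_transC : transitive (fun a b : C => b <= a).
Proof. by move=> y x z xy yz; apply: le_trans yz xy. Qed.

(** The order on [C] is only partial; nonnegativity makes the entries comparable, so that sorting
    has a unique result. *)
Lemma sort_ge_perm s t : {in s, forall x, 0 <= x} -> perm_eq s t ->
  sort_ge s = sort_ge t.
Proof.
move=> s0 st; apply/perm_sort_inP: st.
- move=> x y /s0 x0 /s0 y0; rewrite orbC.
  by apply: real_leVge; apply: ger0_real.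
- by move=> y x z _ _ _; apply: ge_transC.
- by move=> x y _ _ /= /andP[yx xy]; apply/le_anti; rewrite xy.
Qed.

(** In a decreasing list the entries that are at least [t] form a prefix, and indices start at 0.
    This converts bounds on sorted entries into counts. *)
Lemma ltn_count_sorted_ge t s j : (j < size s)%N ->
  sorted (fun a b : C => b <= a) s ->
  (j < count (>= t) s)%N = (t <= s`_j).
Proof.
elim: s j => [|x s IH] //= j js ps.
have sx : all (<= x) s by apply: (order_path_min ge_transC).
have [tx|tx] /= := boolP (t <= x).
  by case: j js => [|j] js //=; rewrite add1n ltnS IH ?(path_sorted ps).
have ns : all (fun y => ~~ (t <= y)) s.
  by apply: sub_all sx => y yx; apply: contra tx => ty; apply: le_trans ty yx.
rewrite add0n (_ : count _ _ = 0)%N; last first.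
  by apply/eqP; rewrite -leqn0 leqNgt -has_count -all_predC.
case: j js => [|j] js /=; first by rewrite (negPf tx).
by apply/esym/negbTE/(allP ns)/mem_nth.
Qed.

Lemma spectrum_ge0 X : psdmx X ->
  {in spectrum (spectral_diag X), forall x, 0 <= x}.
Proof. by move=> pX _ /mapP[i _ ->]; apply: spectral_diag_ge0. Qed.

(** Since [X] is Hermitian, [X^t* *m X] is the square of [X], and the square root of a squared
    nonnegative eigenvalue returns that eigenvalue. *)
Lemma singular_values_psd X : psdmx X ->
  singular_values X = sort_ge (spectrum (spectral_diag X)).
Proof.
move=> pX; pose d := spectral_diag X.
have eX := orthomx_spectralP (psdmx_normal X pX).
have e2 : X^t* *m X =
    invmx (spectralmx X) *m diag_mx (\row_i d 0 i ^+ 2) *m spectralmx X.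
  rewrite psdmx_hermitian // [in LHS]eX -!mulmxA mulKVmx ?spectral_unit //.
  rewrite [diag_mx _ *m (_ *m _)]mulmxA mulmx_diag.
  by congr (_ *m (diag_mx _ *m _)); apply/rowP => i; rewrite !mxE.
have p2 := perm_spectral_diag _ _ _ (spectral_unitarymx X) e2.
symmetry; apply: sort_ge_perm; first exact: spectrum_ge0.
have -> : spectrum (spectral_diag X) = map sqrtC (spectrum (\row_i d 0 i ^+ 2)).
  rewrite /spectrum -map_comp; apply: eq_map => i /=.
  by rewrite mxE sqrCK ?spectral_diag_ge0.
rewrite perm_sym [X in perm_eq X]map_comp.
exact: perm_map p2.
Qed.

Lemma sort_ge_sorted X : psdmx X ->
  sorted (fun a b : C => b <= a) (sort_ge (spectrum (spectral_diag X))).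
Proof.
move=> pX; apply: (@sort_sorted_in _ [in spectrum (spectral_diag X)]);
  last exact/allP.
move=> x y /(spectrum_ge0 _ pX) x0 /(spectrum_ge0 _ pX) y0.
by rewrite orbC; apply: real_leVge; apply: ger0_real.
Qed.

Lemma count_spectrum d (p : pred C) :
  count p (spectrum d) = #|[set i | p (d 0 i)]|.
Proof.
by rewrite count_map cardsE cardE -size_filter [in RHS]/enum_mem enumT. Qed.

(** Take the threshold [t] to be the value for [X] itself: more than [j] eigenvalues of [X] reach
    it, hence more than [j] eigenvalues of [Y] do. *)
Lemma singular_value_mono X Y j : psdmx X -> loewner X Y ->
  singular_value X j <= singular_value Y j.
Proof.
move=> pX XY; have pY : psdmx Y by rewrite -[Y](subrK X); apply: psdmxD.
have size_sv Z : size (sort_ge (spectrum (spectral_diag Z))) = n.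
  by rewrite size_sort size_map size_enum_ord.
rewrite /singular_value !singular_values_psd //; set t := _`_j.
have t0 : 0 <= t.
  apply: (spectrum_ge0 X pX); rewrite -(mem_sort (fun a b : C => b <= a)).
  by apply: mem_nth; rewrite size_sv.
rewrite -ltn_count_sorted_ge ?size_sv ?sort_ge_sorted //.
rewrite count_sort count_spectrum.
apply: leq_trans (leq_card_spectral_diag _ _ _ t0 pX XY).
rewrite -count_spectrum -(count_sort (fun a b : C => b <= a)).
by rewrite ltn_count_sorted_ge ?size_sv ?sort_ge_sorted //.
Qed.

Lemma singular_valueZ c X j : 0 <= c -> psdmx X ->
  singular_value (c *: X) j = c * singular_value X j.
Proof.
move=> c0 pX; rewrite /singular_value !singular_values_psd //;
  last exact: psdmxZ.
have eX := orthomx_spectralP (psdmx_normal X pX).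
have eZ : c *: X = invmx (spectralmx X) *m diag_mx (c *: spectral_diag X)
    *m spectralmx X.
  by rewrite {1}eX linearZ /= -scalemxAr -scalemxAl.
have pZ := perm_spectral_diag _ _ _ (spectral_unitarymx X) eZ.
have -> : sort_ge (spectrum (spectral_diag (c *: X)))
    = map ( *%R c) (sort_ge (spectrum (spectral_diag X))).
  (* Scaling by [c >= 0] keeps the list decreasing, so the right side equals its own sort and only a
     permutation is left to check. *)
  rewrite -[RHS](sorted_sort ge_transC).
    apply: sort_ge_perm; first exact/spectrum_ge0/psdmxZ.
    apply: perm_trans pZ _; rewrite perm_sym.
    have -> : spectrum (c *: spectral_diag X) =
        map ( *%R c) (spectrum (spectral_diag X)).
      rewrite /spectrum -[RHS]map_comp; apply: eq_map => i.
      by rewrite /= mxE.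
    exact/perm_map/permEl/perm_sort.
  apply: homo_sorted (sort_ge_sorted _ pX).
  by move=> x y xy; apply: ler_wpM2l.
by rewrite (nth_map 0) // size_sort size_map size_enum_ord.
Qed.

(** * Gram matrices and square roots *)

Lemma psdmx_gram X : psdmx (X^t* *m X).
Proof.
move=> x; rewrite -!mulmxA mulmxA -trmxC_mul mxE sumr_ge0 // => i _.
by rewrite !mxE mulrC mul_conjC_ge0.
Qed.

(** Both products are positive semidefinite, so their singular values are their eigenvalues, and the
    two share a characteristic polynomial. *)
Lemma singular_value_gramC X j :
  singular_value (X^t* *m X) j = singular_value (X *m X^t* ) j.
Proof.
have pX := psdmx_gram X; have := psdmx_gram (X^t* ); rewrite trmxCK => pXt.
rewrite /singular_value !singular_values_psd //.
congr nth; apply: sort_ge_perm; first exact: spectrum_ge0.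
apply: perm_spectral_diag_char_poly; [exact: psdmx_normal..|].
exact: char_poly_mulmxC.
Qed.

Lemma sqrtmx_hermitian X : psdmx X -> (sqrtmx X)^t* = sqrtmx X.
Proof.
move=> pX; rewrite /sqrtmx invmx_unitary ?spectral_unitarymx //.
rewrite !trmxC_mul trmxCK mulmxA; congr (_ *m _ *m _).
apply/matrixP=> i j; rewrite !mxE eq_sym.
case: eqVneq => [->|_]; last by rewrite mulr0n conjC0.
by rewrite mulr1n; apply/CrealP/ger0_real; rewrite sqrtC_ge0 spectral_diag_ge0.
Qed.

Lemma sqrtmxK X : psdmx X -> sqrtmx X *m sqrtmx X = X.
Proof.
move=> pX; rewrite [RHS](orthomx_spectralP (psdmx_normal X pX)) /sqrtmx.
rewrite -!mulmxA mulKVmx ?spectral_unit //.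
rewrite [diag_mx _ *m (_ *m _)]mulmxA mulmx_diag.
congr (_ *m (diag_mx _ *m _)); apply/rowP => i; rewrite !mxE.
by rewrite -expr2 sqrtCK.
Qed.

Lemma rsqrtmx_sqr X : posdefmx X -> rsqrtmx X *m rsqrtmx X = invmx X.
Proof.
move=> pX; have sK := sqrtmxK X (posdefmx_psd X pX).
have uX := posdefmx_unit X pX; have uS : sqrtmx X \in unitmx.
  by move: uX; rewrite -{1}sK unitmx_mul => /andP[].
rewrite /rsqrtmx; apply: (can_inj (mulmxK uX)).
by rewrite mulVmx // -{3}sK mulmxA mulmxKV // mulVmx.
Qed.

Lemma singular_value_rsqrtmx X D j : posdefmx X -> D^t* = D ->
  singular_value (rsqrtmx X *m (D *m D) *m rsqrtmx X) j =
  singular_value (D *m invmx X *m D) j.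
Proof.
move=> pX hD; have hS : (rsqrtmx X)^t* = rsqrtmx X.
  exact/invmx_hermitian/sqrtmx_hermitian/posdefmx_psd.
have := singular_value_gramC (D *m rsqrtmx X) j.
by rewrite trmxC_mul hS hD !mulmxA -(mulmxA D) rsqrtmx_sqr.
Qed.

(** * Arithmetic and harmonic means *)

Lemma loewner_congr X Y Z :
  loewner X Y -> loewner (Z^t* *m X *m Z) (Z^t* *m Y *m Z).
Proof.
by move=> XY; rewrite /loewner -mulmxBl -mulmxBr; apply: psdmx_congr. Qed.

Lemma loewnerZ c X Y : 0 <= c -> loewner X Y -> loewner (c *: X) (c *: Y).
Proof. by move=> c0 XY; rewrite /loewner -scalerBr; apply: psdmxZ. Qed.

Lemma posdefmx_amean X Y : posdefmx X -> posdefmx Y -> posdefmx (amean X Y).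
Proof.
move=> pX pY; apply: posdefmxZ; first by rewrite invr_gt0 ltr0n.
exact/posdefmxD_psd/posdefmx_psd.
Qed.

Lemma hmeanE X Y : posdefmx X -> posdefmx Y ->
  hmean X Y = X *m invmx (amean X Y) *m Y.
Proof.
move=> pX pY; have uX := posdefmx_unit X pX; have uY := posdefmx_unit Y pY.
have uM := posdefmx_unit _ (posdefmx_amean X Y pX pY).
pose N := 2^-1 *: (invmx X + invmx Y); pose W := X *m invmx (amean X Y) *m Y.
have YN : Y *m N = amean X Y *m invmx X.
  rewrite /N /amean -scalemxAr -scalemxAl mulmxDr mulmxDl !mulmxV //.
  by rewrite addrC.
have WN : W *m N = 1%:M by rewrite /W -mulmxA YN -mulmxA mulKmx // mulmxV.
(* The one-sided inverse [W] already makes the square matrix [N] invertible, so [invmx N] is a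
   genuine inverse and equals [W]. *)
by have [_ uN] := mulmx1_unit WN; rewrite -[RHS](mulmxK uN) WN mul1mx.
Qed.

Lemma amean_sub_hmean X Y : posdefmx X -> posdefmx Y ->
  amean X Y - hmean X Y = 4^-1 *: ((X - Y) *m invmx (amean X Y) *m (X - Y)).
Proof.
move=> pX pY; rewrite hmeanE //.
have uM := posdefmx_unit _ (posdefmx_amean X Y pX pY).
pose D := 2^-1 *: (X - Y).
have two2 : (2 : C) != 0 by rewrite pnatr_eq0.
have eX : X = amean X Y + D.
  rewrite /D /amean -scalerDr addrACA subrr addr0 -mulr2n -scaler_nat scalerA.
  by rewrite mulVf // scale1r.
have eY : Y = amean X Y - D.
  rewrite /D /amean -scalerBr opprB [X + Y]addrC addrACA subrr addr0.
  rewrite -mulr2n -scaler_nat.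
  by rewrite scalerA mulVf // scale1r.
have -> : 4^-1 *: ((X - Y) *m invmx (amean X Y) *m (X - Y)) =
    D *m invmx (amean X Y) *m D.
  rewrite /D -!scalemxAl -scalemxAr scalerA -invfM.
  by rewrite -natrM.
(* Only the outer factors are expanded; the mean under [invmx] stays intact and cancels. *)
rewrite [X in X *m invmx _]eX [X in _ *m invmx _ *m X]eY.
rewrite mulmxDl mulmxV // mulmxDl mul1mx mulmxBr mulmxKV //.
by rewrite addrA subrK opprB addrCA subrr addr0.
Qed.

Lemma posdefmx_sub_hermitian X Y : posdefmx X -> posdefmx Y ->
  (X - Y)^t* = X - Y.
Proof.
move=> /posdefmx_psd/psdmx_hermitian hX /posdefmx_psd/psdmx_hermitian hY.
by rewrite linearB /= map_mxB hX hY.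
Qed.

(** Both gaps equal half of [Y - X]. *)
Lemma loewner_amean X Y : loewner X Y ->
  loewner X (amean X Y) /\ loewner (amean X Y) Y.
Proof.
have half Z : Z = 2^-1 *: (Z + Z).
  by rewrite -mulr2n -scaler_nat scalerA mulVf ?scale1r ?pnatr_eq0.
have h0 : 0 <= 2^-1 :> C by rewrite invr_ge0 ler0n.
have eX : amean X Y - X = 2^-1 *: (Y - X).
  apply: (addIr X); rewrite subrK [X in _ = _ + X]half -scalerDr.
  by rewrite addrA subrK addrC.
have eY : Y - amean X Y = 2^-1 *: (Y - X).
  by apply: (addIr (amean X Y)); rewrite subrK -scalerDr addrA subrK -half.
by move=> XY; rewrite /loewner eX eY; split; apply: psdmxZ.
Qed.

Lemma loewner_amean_sub_hmean X Y : posdefmx X -> posdefmx Y -> loewner X Y ->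
  loewner (4^-1 *: ((X - Y) *m invmx Y *m (X - Y))) (amean X Y - hmean X Y) /\
  loewner (amean X Y - hmean X Y) (4^-1 *: ((X - Y) *m invmx X *m (X - Y))).
Proof.
move=> pX pY XY; rewrite amean_sub_hmean //.
have [XM MY] := loewner_amean X Y XY.
have congr_sub U V : loewner U V ->
    loewner (4^-1 *: ((X - Y) *m U *m (X - Y)))
            (4^-1 *: ((X - Y) *m V *m (X - Y))).
  move=> /(loewner_congr U V (X - Y)); rewrite posdefmx_sub_hermitian //.
  by move=> UV; apply: loewnerZ UV; rewrite invr_ge0 ler0n.
(* Inversion reverses the order: the lower bound uses [amean X Y <= Y], the upper one
   [X <= amean X Y]. *)
split; apply: congr_sub; apply: loewner_inv => //.
exact: posdefmx_amean.
Qed.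

Lemma singular_value_amean_sub_hmean X Y j :
  posdefmx X -> posdefmx Y -> loewner X Y ->
  4^-1 * singular_value (rsqrtmx Y *m (X - Y) ^+ 2 *m rsqrtmx Y) j
    <= singular_value (amean X Y - hmean X Y) j /\
  singular_value (amean X Y - hmean X Y) j
    <= 4^-1 * singular_value (rsqrtmx X *m (X - Y) ^+ 2 *m rsqrtmx X) j.
Proof.
move=> pX pY XY; have [lo hi] := loewner_amean_sub_hmean X Y pX pY XY.
have hD := posdefmx_sub_hermitian X Y pX pY.
have c0 : 0 <= 4^-1 :> C by rewrite invr_ge0 ler0n.
have psd Z : posdefmx Z -> psdmx ((X - Y) *m invmx Z *m (X - Y)).
  by move=> pZ; rewrite -{1}hD; apply/psdmx_congr/psdmx_inv.
have sv Z : posdefmx Z ->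
    4^-1 * singular_value (rsqrtmx Z *m (X - Y) ^+ 2 *m rsqrtmx Z) j =
    singular_value (4^-1 *: ((X - Y) *m invmx Z *m (X - Y))) j.
  move=> pZ; rewrite (singular_valueZ _ _ _ c0 (psd Z pZ)).
  by rewrite -singular_value_rsqrtmx // expr2.
(* What remains is that the smaller matrix of each pair is positive semidefinite. *)
rewrite !sv //; split; apply: singular_value_mono => //.
  exact/psdmxZ/psd.
rewrite amean_sub_hmean //; apply/psdmxZ/psd => //.
exact: posdefmx_amean.
Qed.
End Spectrum.

Theorem theorem2p6 (R : realType) (n : nat) (A B : 'M[R[i]]_n)
    (hA : posdefmx A) (hB : posdefmx B) :
  [/\ amean A B - hmean A B
        = 4^-1 *: ((A - B) *m invmx (amean A B) *m (A - B)),
      loewner A B ->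
        loewner (4^-1 *: ((A - B) *m invmx B *m (A - B)))
                (amean A B - hmean A B)
        /\ loewner (amean A B - hmean A B)
                   (4^-1 *: ((A - B) *m invmx A *m (A - B)))
    & loewner A B -> forall j : 'I_n,
        4^-1 * singular_value (rsqrtmx B *m (A - B) ^+ 2 *m rsqrtmx B) j
          <= singular_value (amean A B - hmean A B) j
        /\ singular_value (amean A B - hmean A B) j
          <= 4^-1 * singular_value (rsqrtmx A *m (A - B) ^+ 2 *m rsqrtmx A) j].
Proof.
split=> [|AB|AB j].
- exact: amean_sub_hmean.
- exact: loewner_amean_sub_hmean.
- exact: singular_value_amean_sub_hmean.
Qed.
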